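(* For every integer $n\ge 1$, $$\sum_{\pi\in\mathtt{NC}(n)}\ \prod_{B\in\pi}q^{\mathrm{wt}(B)}=\frac{1}{[n+1]}\genfrac{[}{]}{0pt}{}{2n}{n},$$ where, for a block $B=\{j_1<j_2<\cdots<j_p\}$, $$\mathrm{wt}(B):=\begin{cases}0,&\text{if }p=1,\\ j_1+j_p+2\sum_{k=2}^{p-1}j_k-p+1,&\text{otherwise.}\end{cases}$$
   Context: $\mathtt{NC}(n)$ is the set of non-crossing partitions of $\{1,\ldots,n\}$, i.e. set partitions $\pi$ such that whenever $a<b<c<d$, $a,c$ lie in a block $B_1$ and $b,d$ lie in a block $B_2$, one has $B_1=B_2$. $B\in\pi$ means that $B$ is a block of $\pi$. Here $[m]:=\sum_{i=0}^{m-1}q^i$ and $\genfrac{[}{]}{0pt}{}{m}{k}:=\frac{(q)_m}{(q)_k(q)_{m-k}}$ with $(q)_m:=(1-q)(1-q^2)\cdots(1-q^m)$. *)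

(* Defs.v *)
From HB Require Import structures.
From mathcomp Require Import all_boot all_order all_algebra.

Set Implicit Arguments.
Unset Strict Implicit.
Unset Printing Implicit Defensive.

Import GRing.Theory.
Local Open Scope ring_scope.

(* The set {1, ..., n} is encoded by 'I_n, with i : 'I_n standing for the
   integer i.+1; the shift matters only in [block_elems]. *)

Definition noncrossing (n : nat) (P : {set {set 'I_n}}) : bool :=
  [forall B1 in P, forall B2 in P,
    [forall a in B1, forall c in B1, forall b in B2, forall d in B2,
      [&& (a < b)%N, (b < c)%N & (c < d)%N] ==> (B1 == B2)]].

Definition NC (n : nat) : {set {set {set 'I_n}}} :=
  [set P : {set {set 'I_n}} | partition P [set: 'I_n] && noncrossing P].

(* The elements j_1 < ... < j_p of a block, as members of {1, ..., n}: [enum]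
   lists ordinals in increasing order. *)
Definition block_elems (n : nat) (B : {set 'I_n}) : seq nat :=
  [seq i.+1 | i : 'I_n <- enum B].

(* The natural-number subtraction is never truncated when p >= 2, since
   j_1 >= 1 and j_p >= p. *)
Definition wt (n : nat) (B : {set 'I_n}) : nat :=
  let p := #|B| in
  let j k := nth 0%N (block_elems B) k.-1 in
  if p == 1%N then 0%N
  else (j 1 + j p + 2 * (\sum_(2 <= k < p) j k) + 1 - p)%N.

Section QAnalogues.
Variables (F : fieldType) (q : F).

Definition qint (m : nat) : F := \sum_(i < m) q ^+ i.

Definition qpoch (m : nat) : F := \prod_(1 <= i < m.+1) (1 - q ^+ i).

(* Used only for k <= m; for k > m the truncated m - k makes it meaningless. *)
Definition qbinom (m k : nat) : F := qpoch m / (qpoch k * qpoch (m - k)).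

End QAnalogues.

(* The indeterminate q, in the field of rational functions over the
   rationals. *)
Definition qvar : {fraction {poly rat}} := tofrac 'X.

(* Main.v *)
Require Import Defs.
From HB Require Import structures.
From mathcomp Require Import all_boot all_order all_algebra.
From mathcomp Require Import ring zify.

Set Implicit Arguments.
Unset Strict Implicit.
Unset Printing Implicit Defensive.

Import GRing.Theory.
Local Open Scope ring_scope.

(** The weight of a block is the sum of [a + b - 1] over its pairs of consecutive
elements [a < b], so a partition can be weighed while its elements are read from
left to right: an element [a] after which the block goes on pays [a], and an element
[b] that continues a block pays [b - 1].

The state of this reading is a partition [P] of the elements read so far together
with the set [O] of its open blocks, those that will receive further elements.  The
final partition is non-crossing exactly when, at every stage, [P] is non-crossing, no
open block is covered by an arc of another block, and a continued block is the
topmost open one ([open_nc_extend]).  So the choices at each element, and what they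
cost, depend only on the number of open blocks.  Let [S(k, h)] be the weight of all
states after [k] elements with [h] open blocks, and split the treatment of an element
in two halves: first it possibly continues, and closes, the topmost open block, then
it possibly opens its block (again).  With [H(k, h) = S(k, h) + q^k S(k, h + 1)] for
the sum after the first half of the next step, one gets
[S(k + 1, h) = H(k, h) + q^(k + 1) H(k, h - 1)] ([open_sumS]), hence
[[
  H(k + 1, h) = (1 + q^(2k + 2)) H(k, h) + q^(k + 1) (H(k, h - 1) + H(k, h + 1)).
]]
This recursion is solved by the q-ballot numbers
[[
  H(k, h) = q^(h (h + 1) / 2) [h + 1] / [k + 1] * qbinom(2k + 2, k - h)
]]
([qballotS]), whereas [S(k, h)] itself has no such product form in general; this is
why the half step is the quantity to compute.  The last element opens nothing, so the sum
over non-crossing partitions is [S(n, 0) = H(n - 1, 0)], the q-Catalan number. *)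

(** * q-ballot numbers *)

Section QBallot.
Variables (F : fieldType) (q : F).
Hypothesis q0 : q != 0.
Hypothesis q1 : forall m, 1 - q ^+ m.+1 != 0.

Lemma qintE m : qint q m = (1 - q ^+ m) / (1 - q).
Proof.
have h : 1 - q != 0 by have := q1 0; rewrite expr1.
by rewrite -[1 - q ^+ m]opprB subrX1 -mulNr opprB /qint mulrC mulKf.
Qed.

Lemma qpochS m : qpoch q m.+1 = qpoch q m * (1 - q ^+ m.+1).
Proof. by rewrite /qpoch big_nat_recr. Qed.

Lemma qpoch_neq0 m : qpoch q m != 0.
Proof.
elim: m => [|m IH]; first by rewrite /qpoch big_geq ?oner_neq0.
by rewrite qpochS mulf_neq0.
Qed.

(** The value [0] for [k > m] is what makes [iqpoch_diffS] hold for all [m] and [k]: the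
recursion of the q-ballot numbers then needs no separate treatment of large heights. *)
Definition iqpoch_diff m k : F :=
  if (k <= m)%N then (qpoch q (m - k))^-1 else 0.

Lemma iqpoch_diffSS m k : iqpoch_diff m.+1 k.+1 = iqpoch_diff m k.
Proof. by rewrite /iqpoch_diff ltnS subSS. Qed.

Lemma iqpoch_diffS m k :
  iqpoch_diff m k = (1 - q ^+ m.+1 / q ^+ k) * iqpoch_diff m.+1 k.
Proof.
rewrite /iqpoch_diff; case: (leqP k m) => hk.
  rewrite (leqW hk) -{1}(subnK (leqW hk)) exprD mulfK ?expf_neq0 //.
  by rewrite subSn // qpochS invfM mulrCA mulfV ?mulr1.
case: leqP => [hk'|]; last by rewrite mulr0.
have -> : k = m.+1 by apply/eqP; rewrite eqn_leq hk hk'.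
by rewrite divff ?expf_neq0 // subrr mul0r.
Qed.

(** The q-ballot number [q^(h (h + 1) / 2) [h + 1] / [t + 1] * qbinom(2t + 2, t - h)]. *)
Definition qballot t h : F :=
  q ^+ 'C(h.+1, 2) * (1 - q ^+ h.+1) / (1 - q ^+ t.+1) * qpoch q (2 * t).+2
  * iqpoch_diff t h / qpoch q (t + h).+2.

(** All four terms are rational multiples of the same product of q-factorials, and the
multiples are rational functions of [q], [q ^+ t.+1] and [q ^+ h]; what remains is an
identity between these. *)
Lemma qballotS t h :
  qballot t.+1 h = (1 + q ^+ (2 * t).+2) * qballot t h
   + q ^+ t.+1 * (if h is h'.+1 then qballot t h' else 0)
   + q ^+ t.+1 * qballot t h.+1.
Proof.
(* Every power of [q] is expressed through [q ^+ t.+1], [q ^+ h] and [q]. *)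
have -> : q ^+ (2 * t).+2 = q ^+ t.+1 ^+ 2.
  by rewrite -exprM; congr (_ ^+ _); lia.
rewrite /qballot.
have -> : iqpoch_diff t h.+1 = (1 - q ^+ t.+1 / q ^+ h.+1) * iqpoch_diff t h.
  by rewrite iqpoch_diffS iqpoch_diffSS.
rewrite (iqpoch_diffS t h).
have -> : (2 * t.+1).+2 = (2 * t).+4 by lia.
rewrite addnS !addSn [qpoch q (2 * t).+4]qpochS [qpoch q (2 * t).+3]qpochS.
have -> : q ^+ (2 * t).+4 = q ^+ t.+1 ^+ 2 * q ^+ 2.
  by rewrite -exprM -exprD; congr (_ ^+ _); lia.
have -> : q ^+ (2 * t).+3 = q ^+ t.+1 ^+ 2 * q.
  by rewrite -exprM -exprSr; congr (_ ^+ _); lia.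
have e3 : q ^+ (t + h).+3 = q ^+ t.+1 * q ^+ h * q ^+ 2.
  by rewrite -!exprD; congr (_ ^+ _); lia.
have e2 : q ^+ (t + h).+2 = q ^+ t.+1 * q ^+ h * q.
  by rewrite -exprD -exprSr; congr (_ ^+ _); lia.
have n3 := q1 (t + h).+2; have n2 := q1 (t + h).+1; rewrite e3 in n3; rewrite e2 in n2.
have nt := q1 t; have nt1 := q1 t.+1; rewrite exprSr in nt1.
have nP := qpoch_neq0 (t + h).+1.
rewrite (qpochS (t + h).+2) (qpochS (t + h).+1) e3 e2 (exprSr q t.+1).
case: h => [|h] in e2 e3 n2 n3 nP *.
  rewrite !addn0 in nP *; rewrite !(binS _ 1) !bin1 !addn0 /= ?bin0n ?addn0.
  rewrite !expr1 !expr0 ?mulr1 in n2 n3 *; rewrite expr2.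
  by field; rewrite nt nt1 n3 q0 nP oner_neq0.
have expr_bin2 m : q ^+ 'C(m.+1, 2) = q ^+ 'C(m, 2) * q ^+ m by rewrite binS bin1 exprD.
rewrite -(iqpoch_diffSS t h) (expr_bin2 h.+2) (expr_bin2 h.+1).
rewrite -(addnS t h).
move: n2 n3; rewrite !(exprSr q h.+2) !(exprSr q h.+1) !(exprSr q h) => n2 n3.
have nh : q ^+ h != 0 by rewrite expf_neq0.
by field; rewrite nt nt1 n2 n3 q0 nP nh.
Qed.

Lemma qballot0 h : qballot 0 h = (h == 0%N)%:R.
Proof.
rewrite /qballot; case: h => [|h]; last by rewrite /iqpoch_diff /= mulr0 mul0r.
rewrite /iqpoch_diff /= muln0 addn0 !subn0 -[in RHS](@mulfV _ (qpoch q 2)) ?qpoch_neq0 //.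
have := q1 0; have := qpoch_neq0 2.
by rewrite {3}/qpoch big_geq // invr1 mulr1 expr0 mul1r expr1 => _ nq; rewrite mulfV ?mul1r.
Qed.

Lemma qballot_height0 t : qballot t 0 = (qint q t.+2)^-1 * qbinom q (2 * t.+1) t.+1.
Proof.
rewrite /qballot /qbinom qintE /iqpoch_diff leq0n subn0 addn0.
rewrite (_ : 2 * t.+1 = (2 * t).+2)%N; last lia.
rewrite (_ : (2 * t).+2 - t.+1 = t.+1)%N; last lia.
rewrite bin_small // expr0 mul1r expr1 (qpochS t.+1) (qpochS t).
have := q1 0; rewrite expr1 => nq.
by field; rewrite nq qpoch_neq0 !q1.
Qed.


End QBallot.

(** * Inserting an element into a set partition *)

Section Insert.
Variables (T : finType) (V : nmodType) (x : T).
Implicit Types (D B : {set T}) (P O : {set {set T}}).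

Definition extend_block B P := (x |: B) |: (P :\ B).

Lemma notin_block P D B : x \notin D -> partition P D -> B \in P -> x \notin B.
Proof. by move=> xD pP /(partitionS pP) /subsetP sB; apply: contra xD => /sB. Qed.

Lemma notin_setU1 P D B : x \notin D -> partition P D -> (x |: B) \notin P.
Proof. by move=> xD pP; apply/negP => /(notin_block xD pP); rewrite setU11. Qed.

Lemma set1_notin P D : x \notin D -> partition P D -> [set x] \notin P.
Proof. by move=> xD pP; apply/negP => /(notin_block xD pP); rewrite set11. Qed.

Lemma partition_add1 P D : x \notin D -> partition P D -> partition ([set x] |: P) (x |: D).
Proof.
move=> xD pP; apply: partitionU1 => //; last by rewrite disjoints1.
by apply/set0Pn; exists x; rewrite set11.
Qed.

Lemma partition_extend P D B :
  x \notin D -> partition P D -> B \in P -> partition (extend_block B P) (x |: D).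
Proof.
move=> xD pP BP; have sB := partitionS pP BP.
have -> : x |: D = (x |: B) :|: (D :\: B) by rewrite -setUA -{1}(setID D B) (setIidPr sB).
apply: partitionU1; first exact: partitionD1.
  by apply/set0Pn; exists x; rewrite setU11.
rewrite -setI_eq0; apply/eqP/setP=> y; rewrite !inE.
by case: eqP => [->|_]; rewrite ?(negPf xD) ?andbF //; case: (y \in B).
Qed.

Lemma set1_notin_extend P D B :
  x \notin D -> partition P D -> B \in P -> [set x] \notin extend_block B P.
Proof.
move=> xD pP BP; rewrite !inE (negPf (set1_notin xD pP)) andbF orbF.
have xB := notin_block xD pP BP.
apply: contraTneq (partition_neq0 pP BP) => e; rewrite negbK -subset0.
apply/subsetP => y yB; have : y \in [set x] by rewrite e inE yB orbT.
by rewrite inE => /eqP yx; rewrite -yx yB in xB.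
Qed.

Lemma pblock_extend P D B :
  x \notin D -> partition P D -> B \in P -> pblock (extend_block B P) x = x |: B.
Proof.
move=> xD pP BP; apply: def_pblock; rewrite ?setU11 //.
exact: partition_trivIset (partition_extend xD pP BP).
Qed.

(** The inverse of [extend_block] on the partitions in which [x] is not alone: it also
returns the block that had been extended. *)
Definition shrink_block P :=
  ((pblock P x :\ x) |: (P :\ pblock P x), pblock P x :\ x).

Lemma extend_blockK P D B : x \notin D -> partition P D -> B \in P ->
  shrink_block (extend_block B P) = (P, B).
Proof.
move=> xD pP BP; rewrite /shrink_block (pblock_extend xD pP BP).
rewrite setU1K ?(notin_block xD pP BP) // /extend_block setU1K ?setD1K //.
by rewrite inE (negPf (notin_setU1 B xD pP)) andbF.
Qed.

Lemma shrink_blockK P D : x \notin D -> partition P (x |: D) -> [set x] \notin P ->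
  [/\ partition (shrink_block P).1 D, (shrink_block P).2 \in (shrink_block P).1
   & extend_block (shrink_block P).2 (shrink_block P).1 = P].
Proof.
move=> xD pP x1P; rewrite /shrink_block /=; set B := pblock P x.
have xc : x \in cover P by rewrite (cover_partition pP) setU11.
have BP : B \in P by rewrite pblock_mem.
have xB : x \in B by rewrite mem_pblock.
have sB := partitionS pP BP.
have notP : B :\ x \notin P :\ B.
  apply/negP; rewrite inE => /andP[ne BxP].
  have /set0Pn[y yB] := partition_neq0 pP BxP.
  have tP := partition_trivIset pP.
  have e := def_pblock tP BxP yB.
  move: yB; rewrite inE => /andP[_ yB].
  by rewrite -e (def_pblock tP BP yB) inE eqxx in ne.
have pr : partition ((B :\ x) |: (P :\ B)) D.
  have -> : D = (B :\ x) :|: ((x |: D) :\: B).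
    apply/setP=> y; rewrite !inE; have [->|yx] := eqVneq y x.
      by rewrite xB (negPf xD).
    by have [/(subsetP sB)|] := boolP (y \in B); rewrite ?inE ?(negPf yx).
  apply: partitionU1; first exact: partitionD1.
    apply: contra x1P => /eqP e.
    suff -> : [set x] = B by [].
    by rewrite -(setD1K xB) e setU0.
  rewrite -setI_eq0; apply/eqP/setP=> y; rewrite !inE.
  by case: (y \in B); rewrite ?andbF.
split=> //; first by rewrite setU11.
by rewrite /extend_block setD1K // setU1K // setD1K.
Qed.

(** A partition of [x |: D] comes from a unique partition of [D], either by adding the
block [[set x]] or by putting [x] in one of the existing blocks. *)
Lemma sum_partition_setU1 D (f : {set {set T}} -> V) : x \notin D ->
  \sum_(P | partition P (x |: D)) f P =
  \sum_(P | partition P D) (f ([set x] |: P) + \sum_(B in P) f (extend_block B P)).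
Proof.
move=> xD; rewrite big_split /= (bigID (fun P => [set x] \in P)) /=; congr (_ + _).
  rewrite (reindex_onto (fun P => [set x] |: P) (fun P => P :\ [set x])) /=.
    apply: eq_bigl => P; apply/idP/idP.
      case/andP=> /andP[pP _] /eqP e.
      have := partitionD1 pP (setU11 _ _).
      by rewrite e setU1K.
    move=> pP; rewrite partition_add1 // setU11 setU1K ?eqxx //.
    exact: set1_notin xD pP.
  by move=> P /andP[_ ?]; rewrite setD1K.
rewrite pair_big_dep /=.
rewrite (reindex_onto (fun p => extend_block p.2 p.1) shrink_block) /=; last first.
  by move=> P /andP[pP nP]; case: (shrink_blockK xD pP nP).
apply: eq_bigl => -[P B] /=; apply/idP/idP.
  case/andP=> /andP[pP nP] /eqP e; case: (shrink_blockK xD pP nP).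
  by rewrite e /= => -> ->.
case/andP=> pP BP.
by rewrite (partition_extend xD pP BP) (set1_notin_extend xD pP BP) (extend_blockK xD pP BP) eqxx.
Qed.

Lemma sum_subset_setU1 (S : finType) (a : S) (A : {set S}) (g : {set S} -> V) : a \notin A ->
  \sum_(O : {set S} | O \subset a |: A) g O = \sum_(O : {set S} | O \subset A) (g O + g (a |: O)).
Proof.
move=> aA; rewrite big_split /= addrC (bigID (fun O : {set S} => a \in O)) /=; congr (_ + _).
  rewrite (reindex_onto (fun O : {set S} => a |: O) (fun O : {set S} => O :\ a)) /=.
    apply: eq_bigl => O /=; apply/idP/idP.
      case/andP=> /andP[sO _] /eqP e.
      by have := setSD [set a] sO; rewrite e setU1K.
    move=> sO; rewrite setUS // setU11 setU1K ?eqxx //.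
    by apply: contra aA; apply: (subsetP sO).
  by move=> O /andP[_ ?]; rewrite setD1K.
apply: eq_bigl => O; apply/idP/idP.
  by case/andP=> sO aO; rewrite -(setU1K aA) subsetD1 sO.
move=> sO; rewrite (subset_trans sO) ?subsetUr //=.
by apply: contra aA; apply: (subsetP sO).
Qed.

(** The version of [sum_partition_setU1] for partitions with a set [O] of marked blocks: the
block of [x] may be marked or not, and when [x] joins a block [B], that block is counted as
marked beforehand, so that the inner sum ranges over [O] rather than over [P]. *)
Lemma sum_marked_partition_setU1 D (g : {set {set T}} -> {set {set T}} -> V) : x \notin D ->
  \sum_(P | partition P (x |: D)) \sum_(O : {set {set T}} | O \subset P) g P O =
  \sum_(P | partition P D) \sum_(O : {set {set T}} | O \subset P)
    (g ([set x] |: P) O + g ([set x] |: P) ([set x] |: O)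
     + \sum_(B in O) (g (extend_block B P) (O :\ B)
                      + g (extend_block B P) (extend_block B O))).
Proof.
move=> xD; rewrite sum_partition_setU1 //; apply: eq_bigr => P pP.
rewrite big_split /= sum_subset_setU1; last exact: set1_notin xD pP.
congr (_ + _).
rewrite (exchange_big_dep (mem P)) /=; last by move=> O B sO; apply: (subsetP sO).
apply: eq_bigr => B BP.
rewrite /extend_block sum_subset_setU1; last first.
  by rewrite inE (negPf (notin_setU1 B xD pP)) andbF.
rewrite (reindex_onto (fun O => O :\ B) (fun O => B |: O)) /=; last first.
  by move=> O; rewrite subsetD1 => /andP[_ ?]; rewrite setU1K.
apply: eq_bigl => O; apply/idP/idP.
  case/andP=> sO /eqP e; rewrite -{2}e setU11 andbT -e subUset sub1set BP /=.
  exact: subset_trans sO (subD1set _ _).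
by case/andP=> sO BO; rewrite setSD //= setD1K.
Qed.
End Insert.

(** * Non-crossing partitions with open blocks *)

Section Open.
Variable n : nat.
Implicit Types (B : {set 'I_n}) (P O : {set {set 'I_n}}) (x : 'I_n).

Lemma noncrossingP P :
  reflect (forall B1 B2 a b c d, B1 \in P -> B2 \in P -> a \in B1 -> c \in B1 ->
             b \in B2 -> d \in B2 -> (a < b)%N -> (b < c)%N -> (c < d)%N -> B1 = B2)
          (noncrossing P).
Proof.
apply: (iffP idP) => [h|h].
  move=> B1 B2 a b c d P1 P2 a1 c1 b2 d2 ab bc cd.
  move: h => /forall_inP/(_ _ P1)/forall_inP/(_ _ P2)/forall_inP/(_ _ a1).
  move=> /forall_inP/(_ _ c1)/forall_inP/(_ _ b2)/forall_inP/(_ _ d2).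
  by rewrite ab bc cd => /eqP.
apply/forall_inP=> B1 P1; apply/forall_inP=> B2 P2; apply/forall_inP=> a a1.
apply/forall_inP=> c c1; apply/forall_inP=> b b2; apply/forall_inP=> d d2.
by apply/implyP=> /and3P[ab bc cd]; apply/eqP; apply: (h B1 B2 a b c d).
Qed.

(** A block that is still to receive a larger element must not have one of its elements
strictly between two elements of another block, or that element would create a crossing. *)
Definition exposed P O : bool :=
  [forall B1 in O, forall B2 in P, forall b in B1, forall a in B2,
    [forall c in B2, (a < b)%N && (b < c)%N ==> (B1 == B2)]].

Lemma exposedP P O :
  reflect (forall B1 B2 a b c, B1 \in O -> B2 \in P -> a \in B2 -> b \in B1 ->
             c \in B2 -> (a < b)%N -> (b < c)%N -> B1 = B2)
          (exposed P O).
Proof.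
apply: (iffP idP) => [h|h].
  move=> B1 B2 a b c O1 P2 a2 b1 c2 ab bc.
  move: h => /forall_inP/(_ _ O1)/forall_inP/(_ _ P2)/forall_inP/(_ _ b1).
  move=> /forall_inP/(_ _ a2)/forall_inP/(_ _ c2).
  by rewrite ab bc => /eqP.
apply/forall_inP=> B1 O1; apply/forall_inP=> B2 P2; apply/forall_inP=> b b1.
apply/forall_inP=> a a2; apply/forall_inP=> c c2.
by apply/implyP=> /andP[ab bc]; apply/eqP; apply: (h B1 B2 a b c).
Qed.

Definition topmost O B : bool :=
  [forall B' in O, forall a in B', forall b in B, (B' == B) || (a < b)%N].

Lemma topmostP O B :
  reflect (forall B' a b, B' \in O -> a \in B' -> b \in B -> B' != B -> (a < b)%N)
          (topmost O B).
Proof.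
apply: (iffP idP) => [h B' a b O' a' bB ne|h].
  move: h => /forall_inP/(_ _ O')/forall_inP/(_ _ a')/forall_inP/(_ _ bB).
  by rewrite (negPf ne).
apply/forall_inP=> B' O'; apply/forall_inP=> a a'; apply/forall_inP=> b bB.
by case: eqVneq => //= ne; apply: h ne.
Qed.

Definition open_nc P O := noncrossing P && exposed P O.

Section Insertion.
Variables (x : 'I_n) (P : {set {set 'I_n}}).
Hypothesis ltx : forall B b, B \in P -> b \in B -> (b < x)%N.

Let xNB B : B \in P -> x \notin B.
Proof. by move=> BP; apply/negP=> /(ltx BP); rewrite ltnn. Qed.

Let lt_ord (b : 'I_n) B : B \in P -> b \in x |: B -> (b < x)%N -> b \in B.
Proof. by move=> BP; rewrite inE => /orP[/set1P->|//]; rewrite ltnn. Qed.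

Lemma open_nc_add1_open_imp O : O \subset P -> open_nc P O ->
  open_nc ([set x] |: P) ([set x] |: O).
Proof.
move=> sO /andP[/noncrossingP nc /exposedP ex].
have ltO B b : B \in O -> b \in B -> (b < x)%N by move/(subsetP sO); apply: ltx.
apply/andP; split.
  apply/noncrossingP=> B1 B2 a b c d /setU1P[->|P1] /setU1P[->|P2] //.
  - move=> /set1P-> /set1P-> _ _ ab bc; lia.
  - move=> _ _ /set1P-> /set1P-> ab bc cd; lia.
  - exact: nc.
apply/exposedP=> B1 B2 a b c /setU1P[->|O1] /setU1P[->|P2] //.
- by move=> a2 /set1P-> c2 _; move: (ltx P2 c2); lia.
- move=> /set1P-> _ /set1P-> ab bc; lia.
- exact: ex.
Qed.

Lemma open_nc_sub P' O O' : O \subset O' -> open_nc P' O' -> open_nc P' O.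
Proof.
move=> /subsetP sO /andP[nc /exposedP ex]; rewrite /open_nc nc.
by apply/exposedP=> B1 B2 a b c /sO; apply: ex.
Qed.

Lemma open_nc_add1_inv O : open_nc ([set x] |: P) O -> open_nc P O.
Proof.
move=> /andP[/noncrossingP nc /exposedP ex]; apply/andP; split.
  by apply/noncrossingP=> B1 B2 a b c d P1 P2; apply: nc; apply: setU1r.
by apply/exposedP=> B1 B2 a b c O1 P2; apply: ex => //; apply: setU1r.
Qed.

Lemma open_nc_add1_open O : O \subset P ->
  open_nc ([set x] |: P) ([set x] |: O) = open_nc P O.
Proof.
move=> sO; apply/idP/idP; last exact: open_nc_add1_open_imp.
by move/(open_nc_sub (subsetUr _ _))/open_nc_add1_inv.
Qed.

Lemma open_nc_add1 O : O \subset P -> open_nc ([set x] |: P) O = open_nc P O.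
Proof.
move=> sO; apply/idP/idP; first exact: open_nc_add1_inv.
move=> h; apply: open_nc_sub (subsetUr [set [set x]] O) _.
by rewrite open_nc_add1_open.
Qed.

(** A crossing between [x |: B] and another block either is one of [B], or uses [x] as its
largest point and then shows that [B] was not exposed.  The open blocks other than [B] stay
exposed because they lie entirely to the left of [B]. *)
Lemma open_nc_extend_top O B : O \subset P -> B \in O -> open_nc P O -> topmost O B ->
  open_nc (extend_block x B P) (extend_block x B O).
Proof.
move=> sO BO /andP[/noncrossingP nc /exposedP ex] /topmostP top.
have BP := subsetP sO _ BO.
apply/andP; split.
  apply/noncrossingP=> B1 B2 a b c d /setU1P[->|/setD1P[n1 P1]] /setU1P[->|/setD1P[n2 P2]] //.
  - move=> a1 c1 b2 d2 ab bc cd; have dx := ltx P2 d2.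
    case/eqP: n2; apply/esym/(nc B B2 a b c d) => //; apply: lt_ord => //; lia.
  - move=> a1 c1 b2; rewrite inE => /orP[/set1P->|d2] ab bc cd; case/eqP: n1.
      by apply/esym/(ex B B1 a b c) => //; apply: lt_ord => //; lia.
    by apply: (nc B1 B a b c d) => //; apply: lt_ord => //; have := ltx BP d2; lia.
  - exact: nc.
apply/exposedP=> B1 B2 a b c /setU1P[->|/setD1P[n1 O1]] /setU1P[->|/setD1P[n2 P2]] //.
- move=> a2 b1 c2 ab bc; have cx := ltx P2 c2.
  by case/eqP: n2; apply/esym/(ex B B2 a b c) => //; apply: lt_ord => //; lia.
- move=> a2 b1 c2 ab bc; have bx := ltx (subsetP sO _ O1) b1.
  have aB : a \in B by apply: lt_ord => //; lia.
  by have := top B1 b a O1 b1 aB n1; lia.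
- exact: ex.
Qed.

(** Conversely, [x] together with an element of [B] covers everything in between, so an open
block that reaches beyond an element of [B] would no longer be exposed. *)
Lemma open_nc_extend_inv O B : trivIset P -> O \subset P -> B \in O ->
  open_nc (extend_block x B P) (O :\ B) -> open_nc P O && topmost O B.
Proof.
move=> tP sO BO /andP[/noncrossingP nc /exposedP ex].
have BP := subsetP sO _ BO.
(* [phi] sends each block of [P] to the block of the extended partition that contains it. *)
pose phi B' := if B' == B then x |: B else B'.
have phiP B' : B' \in P -> phi B' \in extend_block x B P.
  by rewrite /phi; case: eqVneq => [_|ne] P'; rewrite !inE ?eqxx ?ne ?P' ?orbT.
have sphi B' a : a \in B' -> a \in phi B'.
  by rewrite /phi; case: eqVneq => [->|//]; apply: setU1r.
have xphi B1 : B1 \in P -> B1 != x |: B.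
  by move=> P1; apply: contraNneq (xNB P1) => ->; rewrite setU11.
have phiI B1 B2 : B1 \in P -> B2 \in P -> phi B1 = phi B2 -> B1 = B2.
  move=> P1 P2; rewrite /phi; case: eqVneq => [->|n1]; case: eqVneq => [->|n2] //.
    by move/esym/eqP; rewrite (negPf (xphi _ P2)).
  by move/eqP; rewrite (negPf (xphi _ P1)).
have phiB : phi B = x |: B by rewrite /phi eqxx.
have phiN B' : B' != B -> phi B' = B' by rewrite /phi => /negPf->.
rewrite -andbA; apply/and3P; split.
- apply/noncrossingP=> B1 B2 a b c d P1 P2 a1 c1 b2 d2 ab bc cd.
  by apply: phiI => //; apply: (nc _ _ a b c d) => //; auto.
- apply/exposedP=> B1 B2 a b c O1 P2 a2 b1 c2 ab bc.
  have P1 := subsetP sO _ O1; apply: phiI => //.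
  have [e|n1] := eqVneq B1 B.
    apply/esym/(nc _ _ a b c x); auto; last exact: ltx c2.
    by rewrite e phiB setU11.
  rewrite (phiN _ n1); apply: (ex _ _ a b c); auto.
  by rewrite !inE n1.
apply/topmostP=> B' a b O' a' bB ne; have P' := subsetP sO _ O'.
case: (ltngtP a b) => // ab.
  have e : phi B' = phi B.
    rewrite (phiN _ ne); apply: (ex _ _ b a x); auto; last exact: ltx a'.
      by rewrite !inE ne.
    by rewrite phiB setU11.
  by move: ne; rewrite (phiI _ _ P' BP e) eqxx.
move: ne; have e := val_inj ab; rewrite -e in bB.
by rewrite -(def_pblock tP P' a') (def_pblock tP BP bB) eqxx.
Qed.

Lemma open_nc_extend O B : trivIset P -> O \subset P -> B \in O ->
  open_nc (extend_block x B P) (extend_block x B O) = open_nc P O && topmost O B.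
Proof.
move=> tP sO BO; apply/idP/idP; last by case/andP; apply: open_nc_extend_top.
by move/(open_nc_sub (subsetUr _ _))/open_nc_extend_inv; apply.
Qed.

Lemma open_nc_extend_close O B : trivIset P -> O \subset P -> B \in O ->
  open_nc (extend_block x B P) (O :\ B) = open_nc P O && topmost O B.
Proof.
move=> tP sO BO; apply/idP/idP; first exact: open_nc_extend_inv.
by rewrite -open_nc_extend //; apply: open_nc_sub; apply: subsetUr.
Qed.
End Insertion.

Lemma topmost_unique O B1 B2 : set0 \notin O ->
  B1 \in O -> B2 \in O -> topmost O B1 -> topmost O B2 -> B1 = B2.
Proof.
move=> O0 O1 O2 /topmostP t1 /topmostP t2; apply/eqP/negPn/negP => ne.
have /set0Pn[a a1] : B1 != set0 by apply: contraNneq O0 => <-.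
have /set0Pn[b b2] : B2 != set0 by apply: contraNneq O0 => <-.
have := t2 B1 a b O1 a1 b2 ne; have := t1 B2 b a O2 b2 a1; rewrite eq_sym => /(_ ne).
by lia.
Qed.

(** The topmost block is the one that contains the largest element [m] of all open blocks: an
element of another open block to the right of some element of it would be covered, since
it is smaller than [m]. *)
Lemma topmost_exists P O : trivIset P -> set0 \notin P -> O \subset P -> exposed P O ->
  O != set0 -> exists2 B, B \in O & topmost O B.
Proof.
move=> tP P0 sO /exposedP ex /set0Pn[B0 OB0].
have /set0Pn[m0 mB0] : B0 != set0 by apply: contraNneq P0 => <-; apply: (subsetP sO).
have m0c : m0 \in cover O by apply/bigcupP; exists B0.
case: (@arg_maxnP _ m0 (mem (cover O)) val m0c) => m /= mc mmax.
have [B BO mB] := bigcupP mc; exists B => //.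
apply/topmostP=> B' a b O' a' bB ne.
have dis c : c \in B' -> c \in B -> False.
  move=> c' cB; move: ne.
  rewrite -(def_pblock tP (subsetP sO _ O') c') (def_pblock tP (subsetP sO _ BO) cB).
  by rewrite eqxx.
have am : (a <= m)%N by apply: mmax; apply/bigcupP; exists B'.
have {}am : (a < m)%N.
  rewrite ltn_neqAle am andbT; apply/eqP=> /val_inj e.
  by apply: (dis a a'); rewrite e.
case: (ltngtP a b) => // ab.
  by move: ne; rewrite (ex B' B b a m) ?eqxx //; apply: (subsetP sO).
by case: (dis a a'); rewrite (val_inj ab).
Qed.

Lemma sum_topmost (V : nmodType) P D O (c : V) : partition P D -> O \subset P -> open_nc P O ->
  \sum_(B in O | topmost O B) c = if O == set0 then 0 else c.
Proof.
move=> pP sO /andP[_ ex]; case: eqVneq => [->|On].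
  by rewrite big1 // => B; rewrite inE.
have P0 : set0 \notin P by rewrite (partition0 pP).
have [B BO tB] := topmost_exists (partition_trivIset pP) P0 sO ex On.
rewrite (big_pred1 B) // => B'; apply/andP/eqP => [[O' t']|-> //].
by apply: (@topmost_unique O) => //; apply: contra P0; apply: (subsetP sO).
Qed.

End Open.

(** * The weight of a block with a new largest element *)

Section Weight.
Variable n : nat.
Implicit Types (B : {set 'I_n}) (P O : {set {set 'I_n}}) (x : 'I_n).

(** As in [block_elems], the index [i] stands for the integer [i.+1]; the value is [0] on the
empty set. *)
Definition block_max B : nat := \max_(i in B) i.+1.

Lemma sorted_enum_set B : sorted (fun i j : 'I_n => i < j)%N (enum B).
Proof.
rewrite /enum_mem; apply: sorted_filter => [i j k|]; first exact: ltn_trans.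
by rewrite -enumT -(sorted_map (f := val) (e' := ltn)) val_enum_ord iota_ltn_sorted.
Qed.

Lemma enum_add_max x B : (forall b, b \in B -> (b < x)%N) ->
  enum (x |: B) = rcons (enum B) x.
Proof.
move=> ltx; apply: (@irr_sorted_eq _ (fun i j : 'I_n => i < j)%N).
- by move=> i j k; apply: ltn_trans.
- by move=> i; apply: ltnn.
- exact: sorted_enum_set.
- have := sorted_enum_set B; have : all (fun b : 'I_n => b < x)%N (enum B).
    by apply/allP=> b; rewrite mem_enum; apply: ltx.
  case: (enum B) => //= y s /andP[yx sx] ps; rewrite rcons_path ps /=.
  by case/lastP: s sx {ps} => [|s z] //; rewrite all_rcons last_rcons => /andP[].
- by move=> i; rewrite mem_rcons inE !mem_enum !inE.
Qed.

Lemma block_elems_add_max x B : (forall b, b \in B -> (b < x)%N) ->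
  block_elems (x |: B) = rcons (block_elems B) x.+1.
Proof. by move=> ltx; rewrite /block_elems enum_add_max // map_rcons. Qed.

Lemma size_block_elems B : size (block_elems B) = #|B|.
Proof. by rewrite size_map -cardE. Qed.

Lemma last_block_elems B : B != set0 ->
  nth 0%N (block_elems B) #|B|.-1 = block_max B.
Proof.
case/set0Pn=> y0 y0B; case: (@arg_maxnP _ y0 (mem B) val y0B) => y /= yB ymax.
have lty b : b \in B :\ y -> (b < y)%N.
  case/setD1P=> ne bB; rewrite ltn_neqAle (ymax _ bB) andbT.
  by apply: contraNneq ne => /val_inj->.
have := block_elems_add_max lty; rewrite setD1K // => e.
rewrite -size_block_elems nth_last e last_rcons.
apply/esym/eqP; rewrite eqn_leq; apply/andP; split; last exact: leq_bigmax_cond.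
by apply/bigmax_leqP=> b; apply: ymax.
Qed.

(** This keeps the truncated subtraction in [wt] exact. *)
Lemma card_le_block_max B : (#|B| <= block_max B)%N.
Proof.
rewrite cardE -(size_map (fun i : 'I_n => i : nat)) -(size_iota 0 (block_max B)).
apply: uniq_leq_size; first by rewrite map_inj_uniq ?enum_uniq //; apply: val_inj.
move=> _ /mapP[i iB ->]; rewrite mem_iota /=; rewrite mem_enum in iB.
exact: (@leq_bigmax_cond _ (mem B) (fun i : 'I_n => i.+1)).
Qed.

Lemma wt_set1 x : wt [set x] = 0%N.
Proof. by rewrite /wt cards1. Qed.

(** A new arc from [block_max B] to [x.+1] weighs the sum of its ends minus one. *)
Lemma wt_add_max x B : B != set0 -> (forall b, b \in B -> (b < x)%N) ->
  wt (x |: B) = (wt B + block_max B + x)%N.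
Proof.
move=> Bn ltx; have xB : x \notin B by apply/negP=> /ltx; rewrite ltnn.
have := last_block_elems Bn; have := card_le_block_max B.
rewrite /wt block_elems_add_max // cardsU1 xB add1n -size_block_elems.
have : (0 < size (block_elems B))%N by rewrite size_block_elems card_gt0.
case: (block_elems B) => //= a s _ les lasts.
rewrite eqSS nth_rcons /= ltnn eqxx.
case: s => [|b s] in les lasts *.
  by rewrite /= in lasts *; rewrite big_geq // lasts; lia.
rewrite [size (b :: s)]/= in les lasts *.
rewrite /= big_nat_recr //=.
rewrite (eq_big_nat _ _ (F2 := fun k => nth 0%N (a :: b :: s) k.-1)); last first.
  move=> k /andP[k2 ks]; rewrite -!rcons_cons nth_rcons /=.
  by rewrite ifT //; lia.
rewrite -rcons_cons nth_rcons /= ltnSn; rewrite /= in lasts.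
rewrite lasts; lia.
Qed.
End Weight.

(** * The recursion on the number of open blocks *)

Section Transfer.
Variables (n : nat) (F : fieldType) (q : F).
Implicit Types (B : {set 'I_n}) (P O : {set {set 'I_n}}) (x : 'I_n).

(** The arc that will leave an open block pays for its left end in advance. *)
Definition open_weight P O : nat :=
  (\sum_(B in P) wt B + \sum_(B in O) block_max B)%N.

Definition open_term h P O : F :=
  if open_nc P O && (#|O| == h) then q ^+ open_weight P O else 0.

Definition open_sum k h : F :=
  \sum_(P | partition P [set i : 'I_n | (i < k)%N])
    \sum_(O : {set {set 'I_n}} | O \subset P) open_term h P O.

Lemma sum_extend_block (f : {set 'I_n} -> nat) x P B : (x |: B) \notin P -> B \in P ->
  (\sum_(C in extend_block x B P) f C + f B = \sum_(C in P) f C + f (x |: B))%N.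
Proof.
move=> nP BP; rewrite big_setU1 /=; last by rewrite inE (negPf nP) andbF.
by rewrite (big_setD1 B BP) /= -addnA addnC (addnC _ (f B)).
Qed.

Lemma card_extend_block x P B : (x |: B) \notin P -> B \in P -> #|extend_block x B P| = #|P|.
Proof. by move=> nP /(sum_extend_block (fun=> 1%N) nP); rewrite !sum1_card => /addIn. Qed.

Lemma block_max_add_max x B : (forall b, b \in B -> (b < x)%N) -> block_max (x |: B) = x.+1.
Proof.
move=> ltx; apply/eqP; rewrite eqn_leq; apply/andP; split.
  by apply/bigmax_leqP=> b /setU1P[->|/ltx] //; apply: leqW.
exact: (@leq_bigmax_cond _ (mem (x |: B)) (fun i : 'I_n => i.+1) x (setU11 _ _)).
Qed.

Section Step.
Variables (x : 'I_n) (P O : {set {set 'I_n}}).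
Hypothesis pP : partition P [set i : 'I_n | (i < x)%N].
Hypothesis sO : O \subset P.

Let ltx B b : B \in P -> b \in B -> (b < x)%N.
Proof. by move=> /(partitionS pP)/subsetP sB /sB; rewrite inE. Qed.

Let xD : x \notin [set i : 'I_n | (i < x)%N]. Proof. by rewrite inE ltnn. Qed.

Let nO C : C \notin P -> C \notin O. Proof. by apply: contra; apply: (subsetP sO). Qed.

Lemma open_term_add1 h : open_term h ([set x] |: P) O = open_term h P O.
Proof.
rewrite /open_term open_nc_add1 // /open_weight big_setU1 ?(set1_notin xD pP) //=.
by rewrite wt_set1.
Qed.

Lemma open_term_add1_open h :
  open_term h ([set x] |: P) ([set x] |: O)
  = if h is h'.+1 then q ^+ x.+1 * open_term h' P O else 0.
Proof.
have x1 := set1_notin xD pP.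
rewrite /open_term open_nc_add1_open // cardsU1 (nO x1) add1n.
case: h => [|h]; first by rewrite andbF.
rewrite eqSS; case: ifP => _; last by rewrite mulr0.
rewrite /open_weight !big_setU1 ?nO //= wt_set1 -exprD; congr (_ ^+ _).
rewrite -[[set x]]setU0 block_max_add_max; last by move=> b; rewrite inE.
by lia.
Qed.

Lemma open_term_close h B : B \in O ->
  open_term h (extend_block x B P) (O :\ B)
  = if topmost O B then q ^+ x * open_term h.+1 P O else 0.
Proof.
move=> BO; have BP := subsetP sO _ BO; have tP := partition_trivIset pP.
rewrite /open_term open_nc_extend_close //.
rewrite (cardsD1 B O) BO add1n eqSS.
case: (topmost O B); rewrite ?andbT ?andbF //.
case: ifP => _; last by rewrite mulr0.
rewrite -exprD; congr (_ ^+ _); rewrite /open_weight.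
have := sum_extend_block (@wt n) (notin_setU1 B xD pP) BP.
rewrite wt_add_max ?(partition_neq0 pP BP) //; last by move=> b; apply: ltx.
move=> e; apply: (@addIn (wt B)); rewrite addnAC e (big_setD1 B BO) /=.
have aux (a w m y s : nat) : (a + (w + m + y) + s = y + (a + (m + s)) + w)%N by lia.
exact: aux.
Qed.

Lemma open_term_extend h B : B \in O ->
  open_term h (extend_block x B P) (extend_block x B O)
  = if topmost O B then q ^+ x.+1 * q ^+ x * open_term h P O else 0.
Proof.
move=> BO; have BP := subsetP sO _ BO; have tP := partition_trivIset pP.
have nP := notin_setU1 B xD pP.
rewrite /open_term open_nc_extend // card_extend_block ?nO //.
case: (topmost O B); rewrite ?andbT ?andbF //.
case: ifP => _; last by rewrite mulr0.
rewrite -!exprD; congr (_ ^+ _); rewrite /open_weight.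
have ltB b : b \in B -> (b < x)%N by apply: ltx.
have eP := sum_extend_block (@wt n) nP BP.
have eO := sum_extend_block (@block_max n) (nO nP) BO.
rewrite wt_add_max ?(partition_neq0 pP BP) // in eP; rewrite block_max_add_max // in eO.
have aux (a b c d w m y : nat) : (a + w = c + (w + m + y) -> b + m = d + y.+1 ->
  a + b = y.+1 + (y + (c + d)))%N by lia.
by rewrite (aux _ _ _ _ _ _ _ eP eO) !addnA.
Qed.

Lemma sum_topmost_open_term h (c : F) :
  \sum_(B in O) (if topmost O B then c * open_term h P O else 0)
  = if O == set0 then 0 else c * open_term h P O.
Proof.
rewrite -big_mkcondr /=; case onc: (open_nc P O); first exact: sum_topmost pP sO onc.
rewrite /open_term onc /= mulr0 if_same big1 //.
Qed.

Lemma open_term_neq0 h : (if O == set0 then 0 else open_term h P O)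
  = if h is 0 then 0 else open_term h P O.
Proof.
rewrite /open_term -cards_eq0; case: h => [|h].
  by case: ifP => // ->; rewrite andbF.
by case: ifP => // /eqP->; rewrite andbF.
Qed.

(** The element [x] is either the first of its block or goes to the topmost open block;
independently its block is afterwards open or closed. *)
Lemma open_term_step h :
  open_term h ([set x] |: P) O + open_term h ([set x] |: P) ([set x] |: O)
  + \sum_(B in O) (open_term h (extend_block x B P) (O :\ B)
                   + open_term h (extend_block x B P) (extend_block x B O))
  = (open_term h P O + q ^+ x * open_term h.+1 P O)
    + (if h is h'.+1 then
         q ^+ x.+1 * (open_term h' P O + q ^+ x * open_term h P O) else 0).
Proof.
rewrite big_split /= open_term_add1 open_term_add1_open.
rewrite (eq_bigr _ (open_term_close h)) (eq_bigr _ (open_term_extend h)).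
rewrite !sum_topmost_open_term.
have e h' c : (if O == set0 then 0 else c * open_term h' P O)
    = c * (if O == set0 then 0 else open_term h' P O) by case: ifP; rewrite ?mulr0.
rewrite !e !open_term_neq0; case: h => [|h]; ring.
Qed.
End Step.

(** The sum in the middle of a step, after the next element has possibly closed a block and
before it opens one. *)
Definition half_step_sum k h : F := open_sum k h + q ^+ k * open_sum k h.+1.

Lemma open_sumS k h : (k < n)%N ->
  open_sum k.+1 h = half_step_sum k h
    + (if h is h'.+1 then q ^+ k.+1 * half_step_sum k h' else 0).
Proof.
move=> kn; pose x := Ordinal kn.
have -> : open_sum k.+1 h = \sum_(P | partition P (x |: [set i : 'I_n | (i < x)%N]))
    \sum_(O : {set {set 'I_n}} | O \subset P) open_term h P O.
  apply: eq_bigl => P; congr (partition P _); apply/setP=> i.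
  by rewrite !inE ltnS leq_eqVlt.
rewrite sum_marked_partition_setU1 ?inE ?ltnn //.
under eq_bigr => P pP do under eq_bigr => O sO do rewrite (open_term_step pP sO).
rewrite /half_step_sum /open_sum; case: h => [|h].
  rewrite addr0 mulr_sumr -big_split; apply: eq_bigr => P pP.
  rewrite mulr_sumr -big_split; apply: eq_bigr => O sO.
  by rewrite addr0.
rewrite !mulr_sumr -!big_split mulr_sumr -big_split; apply: eq_bigr => P pP.
rewrite !mulr_sumr -!big_split mulr_sumr -big_split; apply: eq_bigr => O sO.
by [].
Qed.

Lemma open_sum0 h : open_sum 0 h = (h == 0%N)%:R.
Proof.
rewrite /open_sum (_ : [set i : 'I_n | _] = set0); last by apply/setP=> i; rewrite !inE.
rewrite (big_pred1 set0); last by move=> P; rewrite partition_set0.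
rewrite (big_pred1 set0); last by move=> O; rewrite subset0.
rewrite /open_term /open_weight !big_set0 cards0 expr0 eq_sym.
rewrite (_ : open_nc _ _); first by case: eqP.
by apply/andP; split; [apply/noncrossingP=> ? ? ? ? ? ?|apply/exposedP=> ? ? ? ? ?]; rewrite inE.
Qed.

Hypothesis q0 : q != 0.
Hypothesis q1 : forall m, 1 - q ^+ m.+1 != 0.

Lemma half_step_sumE k h : (k <= n)%N -> half_step_sum k h = qballot q k h.
Proof.
elim: k h => [|k IH] h kn.
  by rewrite /half_step_sum !open_sum0 mulr0 addr0 qballot0.
rewrite {1}/half_step_sum !open_sumS // qballotS // !IH ?(ltnW kn) //.
have -> : q ^+ (2 * k).+2 = q ^+ k.+1 * q ^+ k.+1 by rewrite -exprD; congr (_ ^+ _); lia.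
case: h => [|h]; rewrite ?IH ?(ltnW kn) //; ring.
Qed.

Lemma open_sum_height0 :
  open_sum n 0 = \sum_(P in NC n) \prod_(B in P) q ^+ wt B.
Proof.
rewrite /open_sum (_ : [set i : 'I_n | _] = setT); last by apply/setP=> i; rewrite !inE ltn_ord.
rewrite [RHS](eq_bigl (fun P => partition P setT && noncrossing P)); last by move=> P; rewrite inE.
rewrite [RHS]big_mkcondr /=; apply: eq_bigr => P pP.
rewrite (bigD1 set0) ?sub0set //= big1 ?addr0; last first.
  by move=> O /andP[_ On]; rewrite /open_term cards_eq0 (negPf On) andbF.
rewrite /open_term cards0 eqxx andbT /open_nc.
have -> : exposed P set0 by apply/exposedP=> B1 B2 a b c; rewrite inE.
by rewrite andbT /open_weight big_set0 addn0 expr_sum.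
Qed.
End Transfer.

Theorem theorem4p3 (n : nat) (hn : (1 <= n)%N) :
  \sum_(P in NC n) \prod_(B in P) qvar ^+ wt B
  = (qint qvar n.+1)^-1 * qbinom qvar (2 * n) n.
Proof.
have q0 : qvar != 0 by rewrite tofrac_eq0 polyX_eq0.
have q1 m : 1 - qvar ^+ m.+1 != 0.
  rewrite -tofracXn -tofrac1 -tofracB tofrac_eq0 subr_eq0.
  by apply/eqP => /(congr1 (fun p : {poly rat} => size p)); rewrite size_polyXn size_poly1.
case: n hn => // n _.
rewrite -open_sum_height0 open_sumS // addr0 half_step_sumE //.
exact: qballot_height0.
Qed.
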